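(* Let $p\in[1,\infty)$, $s>2p$, let $\gamma_S$ be a finite Borel measure on $S$ with $\gamma_S(S)>0$, and let $\mu\in\mathcal P_s(X)$. Let $X_1,\dots,X_n$ be i.i.d. with law $\mu$ and $\mu^n:=\frac1n\sum_{k=1}^n\delta_{X_k}$. Then $$\mathbb E\,SW_p^\gamma(\mu^n,\mu)\le C\,n^{-\frac1{2p}},$$ where $C$ depends only on $p$, $s$ and $M_s(\mu)$.
   Context: $X$ is an infinite-dimensional separable real Hilbert space with inner product $\langle\cdot,\cdot\rangle$ and norm $\|\cdot\|$; $S=\{x\in X:\|x\|=1\}$. $\mathcal P_s(X)$ is the set of Borel probability measures on $X$ with $M_s(\mu):=\int_X\|x\|^s\,d\mu<\infty$. For $\theta\in S$, $P_\theta(x)=\langle\theta,x\rangle$, $\hat\mu_\theta:=P_\theta\#\mu$, and $$SW_p^\gamma(\mu,\nu)=\Big(\frac{1}{\gamma_S(S)}\int_S W_p^p(\hat\mu_\theta,\hat\nu_\theta)\,\gamma_S(d\theta)\Big)^{1/p},$$ with $W_p$ the $p$-Wasserstein distance between probability measures on $\mathbb R$. *)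

(* Defs.v *)
From HB Require Import structures.
From mathcomp Require Import all_boot all_order all_algebra.
Import Order.TTheory GRing.Theory Num.Theory.
From mathcomp Require Import all_classical all_reals all_analysis.
Set Implicit Arguments. Unset Strict Implicit. Unset Printing Implicit Defensive.
Import numFieldNormedType.Exports.
Local Open Scope classical_set_scope.
Local Open Scope ring_scope.

Section Defs.
Variable R : realType.

Definition is_inner_product (X : normedModType R) (ip : X -> X -> R) : Prop :=
  [/\ (forall x y, ip x y = ip y x),
      (forall (a : R) (x y z : X), ip (a *: x + y) z = a * ip x z + ip y z) &
      (forall x, ip x x = `|x| ^+ 2)].

Definition sep_infdim_Hilbert (X : completeNormedModType R) (ip : X -> X -> R) : Prop :=
  [/\ is_inner_product ip,
      (exists D : set X, countable D /\ closure D = setT) &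
      ~ (exists (m : nat) (e : 'I_m -> X),
           forall x : X, exists c : 'I_m -> R, x = \sum_(i < m) c i *: e i)].

Definition borelX (X : normedModType R) := g_sigma_algebraType (@open X).

Definition sphere (X : normedModType R) : set (borelX X) := [set x : X | `|x| = 1].

Definition moment (X : normedModType R) (s : R)
  (mu : {measure set (borelX X) -> \bar R}) : \bar R :=
  (\int[mu]_x (`|(x : X)| `^ s)%:E)%E.

Definition proj_measure (X : normedModType R) (ip : X -> X -> R) (theta : X)
  (mu : set (borelX X) -> \bar R) : set R -> \bar R :=
  fun B => mu ((fun x : X => ip theta x) @^-1` B).

Definition couplings (m1 m2 : set R -> \bar R) : set (probability (R * R)%type R) :=
  [set pi | (forall A : set R, measurable A -> pi (A `*` setT) = m1 A) /\
            (forall B : set R, measurable B -> pi (setT `*` B) = m2 B)].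

Definition Wpp (p : R) (m1 m2 : set R -> \bar R) : \bar R :=
  ereal_inf [set (\int[pi]_z (`|z.1 - z.2| `^ p)%:E)%E | pi in couplings m1 m2].

Definition SWpp (X : normedModType R) (ip : X -> X -> R) (p : R)
  (gamma : {measure set (borelX X) -> \bar R})
  (mu nu : set (borelX X) -> \bar R) : \bar R :=
  (((fine (gamma (@sphere X)))^-1)%:E *
     \int[gamma]_(theta in @sphere X) Wpp p (proj_measure ip theta mu) (proj_measure ip theta nu))%E.

Definition SW (X : normedModType R) (ip : X -> X -> R) (p : R)
  (gamma : {measure set (borelX X) -> \bar R})
  (mu nu : set (borelX X) -> \bar R) : \bar R :=
  poweR (SWpp ip p gamma mu nu) p^-1.

Definition empirical (X : normedModType R) (n : nat) (xs : 'I_n -> borelX X)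
  : set (borelX X) -> \bar R :=
  fun A => ((n%:R^-1)%:E * \sum_(k < n) \d_(xs k) A)%E.

Definition iid (X : normedModType R) (d : measure_display) (Omega : measurableType d)
  (P : probability Omega R) (n : nat) (Xs : 'I_n -> Omega -> borelX X)
  (mu : set (borelX X) -> \bar R) : Prop :=
  [/\ (forall k, measurable_fun setT (Xs k)),
      (forall k (A : set (borelX X)), measurable A -> P (Xs k @^-1` A) = mu A) &
      (forall A : 'I_n -> set (borelX X), (forall k, measurable (A k)) ->
         P [set w | forall k, A k (Xs k w)] = (\prod_(k < n) P (Xs k @^-1` A k))%E)].
End Defs.

(* Main.v *)
Require Import Defs.
From HB Require Import structures.
From mathcomp Require Import all_boot all_order all_algebra.
Import Order.TTheory GRing.Theory Num.Theory.
From mathcomp Require Import all_classical all_reals all_analysis.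
From mathcomp Require Import measurable_realfun ring lra.
Import numFieldNormedType.Exports.
Set Implicit Arguments. Unset Strict Implicit. Unset Printing Implicit Defensive.
Local Open Scope classical_set_scope.
Local Open Scope ring_scope.

(**
On the real line the quantile coupling (F^-1(U), G^-1(U)), U uniform on ]0, 1[, and
|a - b|^p <= 4^p \int_a^b |t|^(p-1) dt give
W_p^p <= 4^p \int |t|^(p-1) |F(t) - G(t)| dt.
For the slice of mu and of its empirical measure in a direction theta, F_n(t) - F(t)
has variance F(t)(1 - F(t)) / n, and Markov's inequality bounds F(1 - F) by
(M_s + 1) min(1, |t|^-s), uniformly in theta. Hence
E W_p^p <= n^(-1/2) 4^p (M_s + 1)^(1/2) \int |t|^(p-1) min(1, |t|^(-s/2)) dt,
where the last integral converges because s > 2p. Tonelli over theta and concavity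
of x^(1/p) conclude.

The integral of a nonnegative function is a supremum over the simple functions below
it, hence monotone without measurability: W_p and SW_p need not be measurable, only
the majorant of W_p^p, for which the separability of X is used.
*)

(** * Quantile coupling on the real line *)

Section quantile.
Context {R : realType} (F : R -> R).

(** Generalized inverse of [F]. Outside []0, 1[] the set may be empty or unbounded below, and [inf]
    then carries no information. *)
Definition quantile (u : R) : R := inf [set x | u <= F x].

Hypothesis Frc : right_continuous F.
Hypothesis FNy : F x @[x --> -oo] --> (0 : R).
Hypothesis Fy : F x @[x --> +oo] --> (1 : R).
Hypothesis Fnd : {homo F : x y / x <= y}.

(** Galois connection between [F] and its generalized inverse. The limits at infinity make the set
    nonempty and bounded below. If [F t < u], right continuity gives [t' > t] with [F t' < u], and
    by monotonicity [t'] is a lower bound of the set. *)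
Lemma quantile_leE (u t : R) : 0 < u < 1 -> (quantile u <= t) = (u <= F t).
Proof.
move=> /andP[u0 u1].
have ne : [set x | u <= F x] !=set0.
  have [M [_ FM]] := cvgr_ge _ Fy _ u1.
  by exists (M + 1); apply: FM; rewrite ltrDl.
have [m ubm] : exists m, forall x, u <= F x -> m <= x.
  have [M [_ FM]] := cvgr_lt _ FNy _ u0.
  exists M => x uFx; rewrite leNgt; apply/negP => xM.
  by have := FM _ xM; rewrite ltNge uFx.
apply/idP/idP => [Qt|uFt]; last by apply: ge_inf => //; exists m => x /ubm.
rewrite leNgt; apply/negP => Ftu.
have Fu := cvgr_lt _ (@Frc t) _ Ftu.
have [t' [tt' Ft'u]] : exists t', t < t' /\ F t' < u.
  have : \forall x \near t^'+, t < x /\ F x < u.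
    by apply: filterI; [exact: nbhs_right_gt|exact: Fu].
  by move/(@filter_ex _ _ (at_right_proper_filter t)) => [x ?]; exists x.
have : t' <= quantile u.
  apply: lb_le_inf => // x /= uFx; rewrite leNgt; apply/negP => /ltW/Fnd.
  by rewrite leNgt (lt_le_trans Ft'u).
by move=> /(lt_le_trans tt'); rewrite ltNge Qt.
Qed.

Lemma measurable_quantile : measurable_fun (`]0, 1[ : set R) quantile.
Proof.
move=> m; apply: (measurability _ (RGenOInfty.measurableE R)) => // _ [_ [t ->] <-].
rewrite (_ : _ `&` _ = (`]0, 1[ : set R) `&` `]F t, +oo[).
  exact: measurableI.
apply/seteqP; split => u /= [u01]; rewrite !in_itv/= !andbT => h; split => //;
  move: u01; rewrite in_itv/= => u01; move: h; rewrite !ltNge quantile_leE//.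
Qed.

End quantile.

(** * The uniform law on the unit interval *)

Section uniform01.
Context {R : realType}.
Local Notation I01 := (`]0%R, 1%R[%classic : set R).
Local Notation U := (uniform_prob (@ltr01 R)).
Local Notation leb := (@lebesgue_measure R).

Lemma integral_uniform01 (f : R -> \bar R) :
  measurable_fun setT f -> (forall x, 0 <= f x)%E ->
  (\int[U]_x f x = \int[leb]_(x in I01) f x)%E.
Proof.
move=> mf f0; rewrite integral_uniform// subr0 invr1 mul1e integral_itv_bndoo//.
exact: measurable_funTS.
Qed.

Lemma uniform01E (A : set R) : measurable A -> U A = leb (A `&` I01).
Proof.
move=> mA; transitivity (\int[U]_x (\1_A x)%:E)%E; first by rewrite integral_indic// setIT.
rewrite integral_uniform01//; first by rewrite integral_indic.
exact/measurable_EFinP.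
Qed.

Lemma uniform01_le (c : R) : 0 <= c <= 1 -> leb (`]-oo, c] `&` I01) = c%:E.
Proof.
move=> /andP[c0 c1]; have [->|c1'] := eqVneq c 1.
  rewrite (_ : _ `&` _ = I01) ?lebesgue_measure_itv/= ?lte_fin ?ltr01 ?sube0//.
  apply/seteqP; split => x /=; rewrite !in_itv/=; [by case|move=> /andP[x0 x1]].
  by rewrite x0 x1 ltW.
rewrite (_ : _ `&` _ = `]0, c]%classic).
  rewrite lebesgue_measure_itv/= lte_fin sube0; case: ifPn => //.
  by rewrite -leNgt => c0'; congr EFin; apply/eqP; rewrite eq_le c0 c0'.
apply/seteqP; split => x /=; rewrite !in_itv/=; [by move=> [xc /andP[-> _]]|move=> /andP[x0 xc]].
by rewrite x0 xc (le_lt_trans xc)// lt_neqAle c1' c1.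
Qed.

End uniform01.

(** * Powers of distances as integrals *)

Section powR_dist.
Context {R : realType}.
Local Notation leb := (@lebesgue_measure R).

Lemma measurable_normpowR (q : R) :
  measurable_fun setT (fun t : R => `|t| `^ q).
Proof.
exact: (@measurableT_comp _ _ _ _ _ _ (fun x : R => x `^ q)).
Qed.

(* The half of [[a, b[] whose midpoint side is away from 0 carries enough mass. *)
Lemma powR_dist_le_integral (p a b : R) : 1 <= p -> a <= b ->
  (((b - a) `^ p)%:E <=
   (4 `^ p)%:E * \int[leb]_(t in `[a, b[) (`|t| `^ (p - 1))%:E)%E.
Proof.
move=> p1 ab; have p0 : 0 < p by rewrite (lt_le_trans _ p1).
have [->|ab'] := eqVneq a b.
  rewrite subrr powR0 ?gt_eqF//; apply: mule_ge0; first by rewrite lee_fin powR_ge0.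
  by apply: integral_ge0 => x _; rewrite lee_fin powR_ge0.
have {ab ab'}ab : a < b by rewrite lt_neqAle ab' ab.
(* The source of [4 ^ p]: on the last quarter of the interval if [0 <= a + b], on the first one
   otherwise, [|t|] is at least [L], so that quarter alone contributes [L * L ^ (p - 1)]. *)
set L := (b - a) / 4.
have L0 : 0 < L by rewrite divr_gt0// subr_gt0.
have [c [ac cb Lc]] : exists c, [/\ a <= c, c + L <= b &
    forall t, c <= t < c + L -> L <= `|t|].
  have [ab0|ab0] := leP 0 (a + b).
  - exists (b - L); rewrite /L; split; [lra|lra|move=> t /andP[t1 t2]].
    by rewrite (le_trans _ (ler_norm _))//; lra.
  - exists a; rewrite /L; split; [lra|lra|move=> t /andP[t1 t2]].
    by rewrite -normrN (le_trans _ (ler_norm _))//; lra.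
have -> : b - a = 4 * L by rewrite /L; lra.
rewrite powRM ?(ltW L0)// EFinM.
rewrite lee_pmul2l// ?lte_fin ?powR_gt0//.
apply: (@le_trans _ _ (\int[leb]_(t in `[c, (c + L)%R[) (L `^ (p - 1))%:E)%E).
  rewrite integral_cst//= lebesgue_measure_itv/= lte_fin ltrDl L0.
  by rewrite -EFinD -EFinM addrAC subrr add0r mulrC mulr_powRB1// ltW.
apply: (@le_trans _ _ (\int[leb]_(t in `[c, (c + L)%R[) (`|t| `^ (p - 1))%:E)%E).
  apply: ge0_le_integral => //.
  - by move=> t _; rewrite lee_fin powR_ge0.
  - by apply/measurable_EFinP/measurable_funTS; exact: measurable_normpowR.
  - move=> t /=; rewrite in_itv/= => /Lc Lt; rewrite lee_fin.
    by apply: ge0_ler_powR; rewrite ?nnegrE ?subr_ge0 ?normr_ge0 ?(ltW L0).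
apply: ge0_subset_integral => //.
- by apply/measurable_EFinP/measurable_funTS; exact: measurable_normpowR.
- move=> t /=; rewrite !in_itv/= => /andP[t1 t2].
  by rewrite (le_trans ac t1) (lt_le_trans t2 cb).
Qed.

(** The difference of indicators is 1 when [t] lies between [a] and [b] and 0 otherwise. As a factor
    of the integrand, rather than a domain depending on [a] and [b], it is ready for Tonelli's
    theorem. *)
Lemma normpowR_dist_le_integral (p a b : R) : 1 <= p ->
  ((`|a - b| `^ p)%:E <= (4 `^ p)%:E *
    \int[leb]_t (`|t| `^ (p - 1) * `|(a <= t)%R%:R - (b <= t)%R%:R|)%:E)%E.
Proof.
move=> p1; wlog ab : a b / a <= b.
  move=> H; have [/H//|/ltW/H] := leP a b.
  by rewrite distrC; under eq_integral do rewrite distrC.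
rewrite distrC ger0_norm ?subr_ge0//.
rewrite (le_trans (powR_dist_le_integral p1 ab))// lee_pmul2l// ?lte_fin ?powR_gt0//.
rewrite integral_mkcond; apply: ge0_le_integral => //.
- by move=> t _; rewrite erestrict_ge0// => ? _; rewrite lee_fin powR_ge0.
- apply/(measurable_restrictT _ _).1 => //.
  by apply/measurable_EFinP/measurable_funTS; exact: measurable_normpowR.
- apply/measurable_EFinP; apply: measurable_funM; first exact: measurable_normpowR.
  apply: (measurableT_comp (@normr_measurable _ setT)) => //.
  have mle (c : R) : measurable_fun setT (fun t : R => (c <= t)%R%:R : R).
    apply: (@measurableT_comp _ _ _ _ _ _ (fun b : bool => b%:R : R)) => //.
    exact: measurable_fun_ler.
  by apply: measurable_funB; exact: mle.
- move=> t _; rewrite patchE; case: ifPn => [|_]; last first.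
    by rewrite lee_fin mulr_ge0// powR_ge0.
  rewrite inE/= in_itv/= => /andP[at_ tb].
  by rewrite at_ (leNgt b) tb subr0 normr1 mulr1.
Qed.

End powR_dist.

(** * Inverse transform sampling *)

Section cdf_quantile.
Context d {T : measurableType d} {R : realType} (P : probability T R).
Variable X : {RV P >-> R}.
Local Notation leb := (@lebesgue_measure R).
Local Notation I01 := (`]0%R, 1%R[%classic : set R).
Local Notation U := (uniform_prob (@ltr01 R)).

Definition rcdf (t : R) : R := fine (cdf X t).

Lemma rcdfK t : (rcdf t)%:E = cdf X t.
Proof. by rewrite fineK// fin_num_measure. Qed.

Lemma rcdf01 t : 0 <= rcdf t <= 1.
Proof. by rewrite -!lee_fin rcdfK cdf_ge0 cdf_le1. Qed.

Lemma rcdf_nondecreasing : {homo rcdf : x y / x <= y}.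
Proof. by move=> x y xy; rewrite -lee_fin !rcdfK cdf_nondecreasing. Qed.

Lemma rcdf_rc : right_continuous rcdf.
Proof.
move=> a; apply: fine_cvg; rewrite fineK ?fin_num_measure//.
exact: cdf_right_continuous.
Qed.

Lemma rcdfNy : rcdf x @[x --> -oo] --> (0 : R).
Proof. exact/fine_cvg/cvg_cdfNy0. Qed.

Lemma rcdfy : rcdf x @[x --> +oo] --> (1 : R).
Proof. exact/fine_cvg/cvg_cdfy1. Qed.

(** Constant off []0, 1[], a set without mass for the uniform law, so as to be measurable on the
    whole line. *)
Definition cdf_quantile : R -> R := quantile rcdf \_ I01.

Lemma cdf_quantile_leE (u t : R) : I01 u -> (cdf_quantile u <= t) = (u <= rcdf t).
Proof.
move=> u01; rewrite /cdf_quantile patchE mem_set//.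
apply: quantile_leE; [exact: rcdf_rc|exact: rcdfNy|exact: rcdfy|exact: rcdf_nondecreasing|].
by move: u01; rewrite /= in_itv.
Qed.

Lemma measurable_cdf_quantile : measurable_fun setT cdf_quantile.
Proof.
apply/(measurable_restrictT _ _).1 => //; apply: measurable_quantile.
- exact: rcdf_rc.
- exact: rcdfNy.
- exact: rcdfy.
- exact: rcdf_nondecreasing.
Qed.

(** By the Galois connection, [cdf_quantile u <= t] amounts to [u <= rcdf t], an event of length
    [rcdf t]. Both laws thus agree on the rays []t, +oo[], which are stable under intersection,
    generate the Borel sets and exhaust the line. *)
Lemma uniform_cdf_quantile (A : set R) : measurable A ->
  U (cdf_quantile @^-1` A) = distribution P X A.
Proof.
have mq : measurable_fun setT (cdf_quantile : measurableTypeR R -> R).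
  exact: measurable_cdf_quantile.
pose q : {mfun (measurableTypeR R) >-> R} := HB.pack cdf_quantile
  (isMeasurableFun.Build _ _ _ _ _ mq).
move=> mA; rewrite -[LHS]/(distribution U q A).
have mray (B : probability R R) t :
    B `]t, +oo[%classic = (1 - B `]-oo, t]%classic)%E.
  by rewrite -probability_setC// setCitvl.
refine (@measure_unique _ R R (@RGenOInfty.G R) (fun k => `](- k%:R : R), +oo[%classic) _ _ _ _ (distribution U q) (distribution P X) _ _ A mA) => //.
- exact: RGenOInfty.measurableE.
- move=> _ _ [x ->] [y ->]; exists (Num.max x y).
  apply/seteqP; split => z /=; rewrite !in_itv/= !andbT gt_max.
    by move=> [-> ->].
  by move=> /andP[-> ->].
- by move=> k; exists (- k%:R).
- apply/seteqP; split => // x _; exists (Num.bound x) => //=.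
  by rewrite in_itv/= andbT ltrNl unstable.ltrNbound.
- move=> _ [t ->]; rewrite [LHS](mray (distribution U q)) [RHS](mray (distribution P X)).
  congr (1 - _)%E.
  change (distribution U q `]-oo, t]%classic = cdf X t).
  rewrite -rcdfK -(uniform01_le (rcdf01 t)).
  rewrite -[LHS]/(U (cdf_quantile @^-1` `]-oo, t])) uniform01E//; last first.
    by rewrite -[X in measurable X]setTI; exact: measurable_cdf_quantile.
  congr (leb _); apply/seteqP; split => u /= [h u01]; split => //;
    move: h; rewrite !in_itv/= cdf_quantile_leE//.
- by move=> k; rewrite ltey_eq fin_num_measure.
Qed.

End cdf_quantile.

(** * Cost of the quantile coupling *)

Section quantile_coupling.
Context d1 d2 {T1 : measurableType d1} {T2 : measurableType d2} {R : realType}.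
Variables (P1 : probability T1 R) (P2 : probability T2 R).
Variables (X1 : {RV P1 >-> R}) (X2 : {RV P2 >-> R}).
Local Notation leb := (@lebesgue_measure R).
Local Notation I01 := (`]0%R, 1%R[%classic : set R).
Local Notation U := (uniform_prob (@ltr01 R)).
Let Q1 := cdf_quantile X1.
Let Q2 := cdf_quantile X2.

Let cross (u t : R) : R := `|(Q1 u <= t)%R%:R - (Q2 u <= t)%R%:R|.

Let mQ1 : measurable_fun setT Q1. Proof. exact: measurable_cdf_quantile. Qed.
Let mQ2 : measurable_fun setT Q2. Proof. exact: measurable_cdf_quantile. Qed.

Let measurable_cross : measurable_fun setT (fun z : R * R => cross z.1 z.2).
Proof.
have mle (Q : R -> R) : measurable_fun setT Q ->
    measurable_fun setT (fun z : R * R => (Q z.1 <= z.2)%R%:R : R).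
  move=> mQ; apply: (@measurableT_comp _ _ _ _ _ _ (fun b : bool => b%:R : R)) => //.
  by apply: measurable_fun_ler => //; exact: measurableT_comp.
apply: (measurableT_comp (@normr_measurable _ setT)) => //.
by apply: measurable_funB; exact: mle.
Qed.

(** For [u] in []0, 1[], [cross u t] is 1 when exactly one of [u <= rcdf X1 t] and [u <= rcdf X2 t]
    holds, that is when [u] lies in []m, M]], an interval of length [|rcdf X1 t - rcdf X2 t|]. *)
Let integral_cross (t : R) :
  (\int[U]_u (cross u t)%:E <= (`|rcdf X1 t - rcdf X2 t|)%:E)%E.
Proof.
have mc : measurable_fun [set: measurableTypeR R] (fun u => (cross u t)%:E).
  apply/measurable_EFinP.
  exact: (measurableT_comp measurable_cross (pair2_measurable t)).
rewrite integral_uniform01//; last by move=> u; rewrite lee_fin normr_ge0.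
set m := Num.min (rcdf X1 t) (rcdf X2 t); set M := Num.max (rcdf X1 t) (rcdf X2 t).
have -> : `|rcdf X1 t - rcdf X2 t| = M - m.
  by rewrite /m /M; have [?|?] := leP (rcdf X1 t) (rcdf X2 t);
    [rewrite ler0_norm ?subr_le0// opprB|rewrite gtr0_norm// subr_gt0].
have mM : m <= M by rewrite /m /M ge_min le_max lexx.
have -> : ((M - m)%:E = \int[leb]_(u in `]m, M]) 1)%E.
  rewrite integral_cst//= mul1e lebesgue_measure_itv/= lte_fin -EFinD.
  by case: ifPn => //; rewrite -leNgt => Mm; congr EFin; lra.
apply: (@le_trans _ _ (\int[leb]_(u in I01) (\1_(`]m, M]%classic : set R) u)%:E)%E).
  apply: ge0_le_integral => //.
  - by move=> u _; rewrite lee_fin normr_ge0.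
  - exact: measurable_funTS.
  - by apply/measurable_EFinP.
  - move=> u u01; rewrite lee_fin /cross !cdf_quantile_leE// indicE.
    have [uM|uM] := boolP (u \in _).
      by case: (u <= rcdf X1 t); case: (u <= rcdf X2 t); rewrite ?subrr ?subr0 ?sub0r ?normrN ?normr0 ?normr1.
    have -> : (u <= rcdf X1 t) = (u <= rcdf X2 t); last by rewrite subrr normr0.
    move: uM; rewrite notin_setE/= in_itv/= /m /M gt_min le_max.
    by rewrite !ltNge; case: (u <= rcdf X1 t); case: (u <= rcdf X2 t) => //= h; case: h.
rewrite integral_indic// integral_cst//= mul1e.
by apply: le_measure; rewrite ?inE//; exact: measurableI.
Qed.

(** The law of [(Q1, Q2)] is one coupling, so its cost bounds the infimum. Tonelli's theorem then
    exchanges [u] and [t], and the inner integral over [u] is at most the gap between the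
    distribution functions. *)
Lemma Wpp_le_cdf (p : R) : 1 <= p ->
  (Wpp p (distribution P1 X1) (distribution P2 X2) <=
   (4 `^ p)%:E *
     \int[leb]_t (`|t| `^ (p - 1) * `|rcdf X1 t - rcdf X2 t|)%:E)%E.
Proof.
move=> p1.
have mQ : measurable_fun setT (fun u : measurableTypeR R => (Q1 u, Q2 u)).
  by apply: measurable_fun_pair; [exact: mQ1|exact: mQ2].
pose Q : {mfun (measurableTypeR R) >-> (R * R)%type} := HB.pack (fun u => (Q1 u, Q2 u))
  (isMeasurableFun.Build _ _ _ _ _ mQ).
pose pi : probability (R * R)%type R := distribution U Q.
apply: (@le_trans _ _ (\int[pi]_z (`|z.1 - z.2| `^ p)%:E)%E).
  apply: ereal_inf_lbound; exists pi => //; split => A mA.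
    rewrite -uniform_cdf_quantile//; congr (U _).
    by apply/seteqP; split => u /= => [[]|].
  rewrite -uniform_cdf_quantile//; congr (U _).
  by apply/seteqP; split => u /= => [[]|].
have mc : measurable_fun setT (fun z : R * R => (`|z.1 - z.2| `^ p)%:E).
  apply/measurable_EFinP.
  apply: (@measurableT_comp _ _ _ _ _ _ (fun x : R => x `^ p)) => //.
  apply: (measurableT_comp (@normr_measurable _ setT)) => //.
  exact: measurable_funB.
rewrite ge0_integral_distribution//=.
have mf : measurable_fun setT
    (fun z : R * R => (`|z.2| `^ (p - 1) * cross z.1 z.2)%:E).
  apply/measurable_EFinP; apply: measurable_funM => //.
  exact: (measurableT_comp (measurable_normpowR _)).
have f0 (z : R * R) : (0 <= (`|z.2| `^ (p - 1) * cross z.1 z.2)%:E)%E.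
  by rewrite lee_fin mulr_ge0// ?powR_ge0 ?normr_ge0.
have mF : measurable_fun [set: measurableTypeR R]
    (fun u => \int[leb]_t (`|t| `^ (p - 1) * cross u t)%:E)%E.
  exact: (@measurable_fun_fubini_tonelli_F _ _ _ _ _ leb
    (fun z : R * R => (`|z.2| `^ (p - 1) * cross z.1 z.2)%:E)).
have mG : measurable_fun [set: measurableTypeR R]
    (fun t => \int[U]_u (`|t| `^ (p - 1) * cross u t)%:E)%E.
  exact: (@measurable_fun_fubini_tonelli_G _ _ _ _ _ U
    (fun z : R * R => (`|z.2| `^ (p - 1) * cross z.1 z.2)%:E)).
apply: (@le_trans _ _ (\int[U]_u ((4 `^ p)%:E *
    \int[leb]_t (`|t| `^ (p - 1) * cross u t)%:E))%E).
  apply: ge0_le_integral => //.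
  - exact: (measurableT_comp mc mQ).
  - exact: emeasurable_funM.
  - by move=> u _ /=; exact: normpowR_dist_le_integral.
rewrite ge0_integralZl//; last first.
  by move=> u _; apply: integral_ge0 => t _; exact: (f0 (u, t)).
rewrite lee_pmul2l// ?lte_fin ?powR_gt0//.
have -> : (\int[U]_u \int[leb]_t (`|t| `^ (p - 1) * cross u t)%:E =
    \int[leb]_t \int[U]_u (`|t| `^ (p - 1) * cross u t)%:E)%E.
  exact: (@fubini_tonelli _ _ _ _ _ U leb
    (fun z : R * R => (`|z.2| `^ (p - 1) * cross z.1 z.2)%:E)).
apply: ge0_le_integral => //.
- by move=> t _; apply: integral_ge0 => u _; exact: (f0 (u, t)).
- apply/measurable_EFinP; apply: measurable_funM; first exact: measurable_normpowR.
  apply: (measurableT_comp (@normr_measurable _ setT)) => //.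
  by apply: measurable_funB; apply: nondecreasing_measurable => //; exact: rcdf_nondecreasing.
- move=> t _ /=; under eq_integral do rewrite EFinM.
  rewrite ge0_integralZl//; last 2 first.
    apply/measurable_EFinP; exact: (measurableT_comp measurable_cross (pair2_measurable t)).
    by move=> u _; rewrite lee_fin normr_ge0.
  by rewrite EFinM lee_wpmul2l// lee_fin powR_ge0.
Qed.

End quantile_coupling.

(** * Measurability of the inner product *)

Section borelX_measurability.
Context {R : realType} {X : normedModType R}.

Lemma measurable_open_borelX (A : set X) : open A -> measurable (A : set (borelX X)).
Proof. by move=> oA; exact: sub_sigma_algebra. Qed.

Lemma measurable_ball_borelX (q : X) (r : R) :
  measurable ([set x : X | `|x - q| < r] : set (borelX X)).
Proof.
apply: measurable_open_borelX.
have -> : [set x : X | `|x - q| < r] = (fun x : X => `|x - q|) @^-1` [set y | y < r].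
  by [].
apply: open_comp => [x _|]; last exact: open_lt.
by apply: cvg_norm; apply: cvgB; [exact: cvg_id|exact: cvg_cst].
Qed.

Lemma measurable_norm_borelX : measurable_fun setT (fun x : borelX X => `|x : X| : R).
Proof.
apply: (measurability _ (RGenInftyO.measurableE R)) => // _ [_ [t ->] <-].
rewrite setTI (_ : _ @^-1` _ = [set x : X | `|x - 0| < t]); first exact: measurable_ball_borelX.
by apply/seteqP; split => x /=; rewrite in_itv/= subr0.
Qed.

Lemma measurable_sphere : measurable (@sphere R X).
Proof.
rewrite (_ : @sphere _ _ = (fun x : borelX X => `|x : X| : R) @^-1` [set 1])//.
by rewrite -[X in measurable X]setTI; exact: measurable_norm_borelX.
Qed.

Hypothesis sepX : exists D : set X, countable D /\ closure D = setT.

Lemma dense_sequence : exists g : nat -> X,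
  forall (x : X) (e : R), 0 < e -> exists n, `|x - g n| < e.
Proof.
have [D [/pcard_surjP[g gD] dD]] := sepX.
exists g => x e e0.
have : closure D x by rewrite dD.
move=> /(_ (ball x e) (nbhsx_ballx x e e0)) [y [Dy]].
have [n _ <-] := gD y Dy.
by rewrite -ball_normE/= => xy; exists n.
Qed.

(** Measurability is for the product sigma-algebra, which continuity does not address directly. A
    dense sequence writes [|x - y| < r] as a countable union of products of balls with common centre
    [g n]. *)
Lemma measurable_dist_borelX :
  measurable_fun setT (fun z : borelX X * borelX X => `|(z.1 : X) - z.2| : R).
Proof.
have [g dg] := dense_sequence.
apply: (measurability _ (RGenInftyO.measurableE R)) => // _ [_ [r ->] <-].
rewrite setTI.
rewrite (_ : _ @^-1` _ = \bigcup_n \bigcup_m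
   (([set x : X | `|x - g n| < m.+1%:R^-1] : set (borelX X)) `*`
    ([set y : X | `|y - g n| < r - m.+1%:R^-1] : set (borelX X)))).
  apply: bigcupT_measurable => n; apply: bigcupT_measurable => m.
  by apply: measurableX; exact: measurable_ball_borelX.
apply/seteqP; split => -[x y]; rewrite /= ?in_itv/=.
  (* Half of the gap: with [e] below it and [|x - g n| < e], one gets
     [|y - g n| < |x - y| + e < r - e]. *)
  move=> xyr; have e0 : 0 < (r - `|(x : X) - y|) / 2 by rewrite divr_gt0// subr_gt0.
  have [m me] : exists m, m.+1%:R^-1 < (r - `|(x : X) - y|) / 2.
    exists (Num.truncn ((r - `|(x : X) - y|) / 2)^-1).
    by rewrite invf_plt ?posrE// truncnS_gt.
  have m0 : (0 : R) < m.+1%:R^-1 by rewrite invr_gt0.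
  have [n xn] := dg x _ m0.
  exists n => //; exists m => //; split => //=.
  have := ler_distD (x : X) y (g n); rewrite (distrC y x).
  move: me xn; rewrite !ltrBrDr; set e := m.+1%:R^-1.
  move: (`|_ - g n|) (`|_ - g n|) (`|_ - y|) => a b c; lra.
move=> [n _ [m _ [/= xn yn]]].
have := ler_distD (g n) (x : X) y; rewrite (distrC (g n) y).
move: xn yn; set e := m.+1%:R^-1.
move: (`|_ - g n|) (`|_ - g n|) (`|_ - y|) => a b c; lra.
Qed.

End borelX_measurability.

(** * Polarization and the Cauchy-Schwarz inequality *)

Section inner_product.
Context {R : realType} {X : normedModType R} (ip : X -> X -> R).
Hypothesis ipX : is_inner_product ip.

(** Serves twice: [c = 1] gives polarization, [c = ip x y] with [x] of norm 1 gives the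
    Cauchy-Schwarz bound. *)
Lemma sqr_normB_ip x y c : `|y - c *: x| ^+ 2 = `|y| ^+ 2 - c * ip x y *+ 2 + c ^+ 2 * `|x| ^+ 2.
Proof.
case: ipX => sym lin nrm; rewrite -!nrm.
have lin' a u v w : ip w (a *: u + v) = a * ip w u + ip w v by rewrite sym lin !(sym _ w).
have -> : y - c *: x = (- c) *: x + y by rewrite scaleNr addrC.
rewrite lin lin' lin' (sym y x); ring.
Qed.

(** Reduces joint measurability of [ip] to that of the norm and of the distance. *)
Lemma ip_polarization x y : ip x y = (`|x| ^+ 2 + `|y| ^+ 2 - `|x - y| ^+ 2) / 2.
Proof. by have := sqr_normB_ip x y 1; rewrite scale1r distrC => ->; field. Qed.

(** The residual [y - ip x y *: x] of the projection on [x] has squared norm [|y|^2 - (ip x y)^2],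
    which is nonnegative. *)
Lemma ip_le_norm x y : `|x| = 1 -> `|ip x y| <= `|y|.
Proof.
move=> x1; rewrite -(ler_pXn2r (n := 2))// ?nnegrE// -normrX ger0_norm ?sqr_ge0//.
have := sqr_normB_ip x y (ip x y); rewrite x1 => h.
have : 0 <= `|y - ip x y *: x| ^+ 2 by rewrite sqr_ge0.
rewrite h; lra.
Qed.

Hypothesis sepX : exists D : set X, countable D /\ closure D = setT.

Lemma measurable_ip : measurable_fun setT (fun z : borelX X * borelX X => ip z.1 z.2).
Proof.
under eq_fun do rewrite ip_polarization.
apply: measurable_funM => //; apply: measurable_funB.
  apply: measurable_funD; apply: measurable_funX;
    exact: (measurableT_comp measurable_norm_borelX).
by apply: measurable_funX; exact: measurable_dist_borelX.
Qed.

Lemma measurable_ipr (x : X) : measurable_fun setT (ip x : borelX X -> R).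
Proof. exact: (measurableT_comp measurable_ip (pair1_measurable (x : borelX X))). Qed.

End inner_product.

Section empirical_probability.
Context {R : realType} {X : normedModType R}.

(** [empirical] is a bare set function, whereas the bound on the line is about probabilities. Taking
    [n.+1] excludes the empty sample, whose total mass is 0. *)
Lemma empirical_probability (n : nat) (xs : 'I_n.+1 -> borelX X) :
  exists Pn : probability (borelX X) R, (Pn : set _ -> _) = empirical xs.
Proof.
have c0 : 0 <= n.+1%:R^-1 :> R by rewrite invr_ge0.
pose m := mscale (NngNum c0)
  (* [msum] is indexed by [nat]; [inord] is the identity on the indices below [n.+1]. *)
  (msum (fun k => \d_(xs (inord k)) : {measure set (borelX X) -> \bar R}) n.+1).
have mE : m = empirical xs.
  apply/funext => A; rewrite /m /mscale /msum /empirical/=; congr (_ * _)%E.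
  by apply: eq_bigr => i _; rewrite inord_val.
have m1 : m setT = 1%E.
  rewrite mE /empirical; under eq_bigr do rewrite diracT.
  rewrite sumEFin sumr_const card_ord -EFinM -mulr_natl mulr1 mulVf//.
pose Pn : probability (borelX X) R := HB.pack m (Measure_isProbability.Build _ _ _ m m1).
by exists Pn.
Qed.

End empirical_probability.

(** * Deviation of empirical frequencies *)

Section frequency_deviation.
Context d (Omega : measurableType d) {R : realType} (P : probability Omega R).
Variables (n : nat) (E : 'I_n -> set Omega) (q : R).
Hypothesis n0 : (0 < n)%N.
Hypothesis mE : forall k, measurable (E k).
Hypothesis PE : forall k, P (E k) = q%:E.
Hypothesis PEE : forall k l, k != l -> P (E k `&` E l) = (q ^+ 2)%:E.

Let S (w : Omega) : R := \sum_(k < n) \1_(E k) w.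

Let mS : measurable_fun setT S.
Proof. by apply: measurable_sum => k; exact: measurable_indic. Qed.

Let S0 w : 0 <= S w. Proof. by apply: sumr_ge0 => k _. Qed.

Let q01 : 0 <= q <= 1.
Proof. by rewrite -!lee_fin -(PE (Ordinal n0)) measure_ge0 probability_le1. Qed.

Let integral_Pcst (c : R) : (\int[P]_w c%:E = c%:E)%E.
Proof. by rewrite integral_cst// [X in (_ * X)%E](probability_setT P) mule1. Qed.

Lemma integral_count : (\int[P]_w (S w)%:E = (n%:R * q)%:E)%E.
Proof.
under eq_integral do rewrite /S -sumEFin.
rewrite ge0_integral_sum//; last first.
  by move=> k; exact/measurable_EFinP/measurable_indic.
rewrite (eq_bigr (fun=> q%:E)); last first.
  move=> k _; rewrite integral_indic// setIT. exact: PE.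
by rewrite sumEFin sumr_const card_ord mulr_natl.
Qed.

(** In the expanded square, the [n] diagonal terms have mean [q], indicators being idempotent, and
    the [n (n - 1)] others have mean [q ^+ 2] by pairwise independence. *)
Lemma integral_count_sqr :
  (\int[P]_w (S w ^+ 2)%:E = (n%:R * q + n%:R * (n%:R - 1) * q ^+ 2)%:E)%E.
Proof.
under eq_integral do rewrite /S expr2 big_distrlr/= -sumEFin.
rewrite ge0_integral_sum//; last 2 first.
- move=> k; apply/measurable_EFinP/measurable_sum => l.
  by apply: measurable_funM; exact: measurable_indic.
- by move=> k w _; rewrite lee_fin sumr_ge0.
have -> : (n%:R * q + n%:R * (n%:R - 1) * q ^+ 2 =
    \sum_(k < n) (q + (n%:R - 1) * q ^+ 2))%R.
  by rewrite sumr_const card_ord -[RHS]mulr_natl; ring.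
rewrite -sumEFin; apply: eq_bigr => k _.
under eq_integral do rewrite -sumEFin.
rewrite ge0_integral_sum//; last first.
  by move=> l; apply/measurable_EFinP/measurable_funM; exact: measurable_indic.
rewrite (bigD1 k)//= (eq_bigr (fun=> (q ^+ 2)%:E)); last first.
  move=> l lk; under eq_integral do rewrite -[(_ * _)%R]/((\1_(E k) \* \1_(E l)) _)%R -indicI.
  have mkl : measurable (E k `&` E l) by exact: measurableI.
  by rewrite integral_indic// setIT; apply: PEE; rewrite eq_sym.
rewrite [X in (X + _)%E](_ : _ = q%:E); last first.
  under eq_integral do rewrite -[(_ * _)%R]/((\1_(E k) \* \1_(E k)) _)%R -indicI setIid.
  by rewrite integral_indic// setIT; exact: PE.
rewrite sumEFin -EFinD sumr_const cardC1 card_ord.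
by congr (_ + _)%:E; rewrite -[LHS]mulr_natl -subn1 natrB.
Qed.

Let dev w : R := n%:R^-1 * S w - q.

Let nR0 : (0 : R) < n%:R. Proof. by rewrite ltr0n. Qed.

Let mdev : measurable_fun setT dev.
Proof. by apply: measurable_funB => //; exact: measurable_funM. Qed.

(* The identity is arranged so that every integrand is nonnegative. *)
Lemma integral_deviation_sqr :
  (\int[P]_w (dev w ^+ 2)%:E = (q * (1 - q) / n%:R)%:E)%E.
Proof.
have [q0 q1] := andP q01.
have eqw w : dev w ^+ 2 + (2 * q / n%:R) * S w = (n%:R ^- 2) * S w ^+ 2 + q ^+ 2.
  by rewrite /dev; field; rewrite gt_eqF.
have : (\int[P]_w ((dev w ^+ 2)%:E + (2 * q / n%:R)%:E * (S w)%:E) =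
        \int[P]_w ((n%:R ^- 2)%:E * (S w ^+ 2)%:E + (q ^+ 2)%:E))%E.
  by apply: eq_integral => w _; rewrite -!EFinM -!EFinD eqw.
have c0 : 0 <= 2 * q / n%:R by rewrite !mulr_ge0// invr_ge0.
have c1 : 0 <= (n%:R : R) ^- 2 by rewrite invr_ge0 exprn_ge0.
rewrite ge0_integralD//=; last 4 first.
- by move=> w _; rewrite lee_fin sqr_ge0.
- by apply/measurable_EFinP; exact: measurable_funX.
- by move=> w _; rewrite -EFinM lee_fin mulr_ge0.
- by apply: emeasurable_funM => //; exact/measurable_EFinP.
rewrite ge0_integralZl//; last 2 first.
- by apply/measurable_EFinP.
- by move=> w _; rewrite lee_fin.
rewrite integral_count.
rewrite ge0_integralD//=; last 3 first.
- by move=> w _; rewrite -EFinM lee_fin mulr_ge0// sqr_ge0.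
- by apply: emeasurable_funM => //; apply/measurable_EFinP; exact: measurable_funX.
- by move=> w _; rewrite lee_fin sqr_ge0.
rewrite ge0_integralZl//; last 2 first.
- by apply/measurable_EFinP; exact: measurable_funX.
- by move=> w _; rewrite lee_fin sqr_ge0.
rewrite integral_count_sqr integral_Pcst.
rewrite -!EFinM -!EFinD => h.
(* The other side of [h] is a real number, so the integral is finite and the equation can be solved
   in [R]. *)
have hfin : (\int[P]_w (dev w ^+ 2)%:E)%E \is a fin_num.
  move: h; case: (\int[P]_w (dev w ^+ 2)%:E)%E => //.
move: h; rewrite -(fineK hfin) -EFinD => -[] h; congr EFin.
rewrite (canRL (addrK _) h).
by field; rewrite gt_eqF.
Qed.

(** Here [a] is any positive upper bound of the standard deviation. The latter may vanish, while the
    proof divides by [a]. *)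
Lemma integral_deviation_le (a : R) : 0 < a -> q * (1 - q) <= n%:R * a ^+ 2 ->
  (\int[P]_w (`|dev w|)%:E <= a%:E)%E.
Proof.
move=> a0 qa.
have a20 : 0 <= (2 * a)^-1 by rewrite invr_ge0 mulr_ge0// ltW.
(* [|z| <= (a + z^2 / a) / 2] replaces Cauchy-Schwarz *)
apply: (@le_trans _ _ (\int[P]_w ((a / 2)%:E + ((2 * a)^-1)%:E * (dev w ^+ 2)%:E))%E).
  apply: ge0_le_integral => //.
  - by apply/measurable_EFinP; exact: measurableT_comp.
  - apply/measurable_EFinP; apply: measurable_funD => //.
    by apply: measurable_funM => //; exact: measurable_funX.
  - move=> w _; rewrite -EFinM -EFinD lee_fin -(real_normK (num_real (dev w))).
    rewrite -subr_ge0 (_ : _ - _ = (2 * a)^-1 * (`|dev w| - a) ^+ 2).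
      by rewrite mulr_ge0// sqr_ge0.
    by field; rewrite gt_eqF.
rewrite ge0_integralD//; last 3 first.
- by move=> w _; rewrite lee_fin divr_ge0// ltW.
- by move=> w _; rewrite -EFinM lee_fin mulr_ge0// sqr_ge0.
- by apply: emeasurable_funM => //; apply/measurable_EFinP; exact: measurable_funX.
rewrite ge0_integralZl//; last 2 first.
- by apply/measurable_EFinP; exact: measurable_funX.
- by move=> w _; rewrite lee_fin sqr_ge0.
rewrite integral_deviation_sqr integral_Pcst.
rewrite -EFinM -EFinD lee_fin -lerBrDl.
rewrite ler_pdivrMl ?mulr_gt0// ler_pdivrMr//.
by rewrite (le_trans qa)// le_eqVlt; apply/orP; left; apply/eqP; field.
Qed.

End frequency_deviation.

(** * Convergence of the tail integral *)

Section tail_integral.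
Context {R : realType}.
Local Notation leb := (@lebesgue_measure R).

Lemma powRN_cvg0y (e : R) : 0 < e -> x `^ (- e) @[x --> +oo] --> (0 : R).
Proof.
move=> e0; apply/cvgr0Pnorm_le => eps eps0; near=> t.
(* The threshold is the solution of [t ^ (- e) = eps]. *)
have t0 : eps `^ (- e^-1) <= t by near: t; apply: nbhs_pinfty_ge; exact: num_real.
have c0 : 0 < eps `^ (- e^-1) by rewrite powR_gt0.
have t0' : 0 < t by rewrite (lt_le_trans c0).
rewrite ger0_norm ?powR_ge0// powRN.
have -> : eps = ((eps `^ (- e^-1)) `^ e)^-1.
  by rewrite -powRrM mulNr mulVf ?gt_eqF// powRN invrK powRr1// ltW.
rewrite lef_pV2 ?posrE ?powR_gt0//.
by apply: ge0_ler_powR => //; rewrite ?nnegrE ltW.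
Unshelve. all: by end_near. Qed.

Lemma continuous_powRl (a x : R) : 0 < x -> {for x, continuous (fun y : R => y `^ a)}.
Proof.
move=> x0; apply: differentiable_continuous; apply/derivable1_diffP.
by apply: derivable_powR; rewrite in_itv/= andbT.
Qed.

Lemma integral_powR_tail (e : R) : 1 < e ->
  (\int[leb]_(x in `[1%R, +oo[) (x `^ (- e))%:E = ((e - 1)^-1)%:E)%E.
Proof.
move=> e1; have e10 : 0 < e - 1 by rewrite subr_gt0.
(* An antiderivative that vanishes at infinity, so the integral is [- F 1]. *)
pose F (x : R) := - (e - 1)^-1 * x `^ (- (e - 1)).
have dF (x : R) : 0 < x -> is_derive x 1 F (x `^ (- e)).
  move=> x0; rewrite /F.
  have -> : x `^ (- e) = - (e - 1)^-1 *: (- (e - 1) * x `^ (- (e - 1) - 1)) :> R^o.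
    rewrite /GRing.scale/= mulrA mulrNN mulVf ?gt_eqF// mul1r; congr (_ `^ _); lra.
  have h : is_derive x 1 (fun y : R => y `^ (- (e - 1)) : R^o) (- (e - 1) * x `^ (- (e - 1) - 1)).
    exact: is_derive1_powR.
  exact: (is_deriveZ (- (e - 1)^-1) h).
have cF (x : R) : 0 < x -> {for x, continuous F}.
  by move=> x0; apply: cvgM; [exact: cvg_cst|exact: continuous_powRl].
rewrite (@ge0_continuous_FTC2y _ _ F _ 0)//.
- rewrite /F powR1 mulr1 -EFinB sub0r opprK//.
- by move=> x _; exact: powR_ge0.
- apply: continuous_in_subspaceT => x; rewrite inE/= in_itv/= andbT => x1.
  by apply: continuous_powRl; rewrite (lt_le_trans ltr01).
- rewrite -[X in _ --> X](mulr0 (- (e - 1)^-1)).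
  by apply: cvgM; [exact: cvg_cst|exact: powRN_cvg0y].
- by move=> x x1; have [] := dF x (lt_trans ltr01 x1).
- by apply: cvg_at_right_filter; exact: cF.
- move=> x; rewrite in_itv/= andbT => x1; rewrite derive1E.
  by have [_ ->] := dF x (lt_trans ltr01 x1).
Qed.

(** For [s > 0] this is [min(1, |t|^(-s/2))], the decay of the standard deviation of a slice; the
    case split keeps the negative power away from 0. *)
Definition tail_weight (s t : R) : R := if `|t| <= 1 then 1 else `|t| `^ (- (s / 2)).

Lemma tail_weight_gt0 s t : 0 < tail_weight s t.
Proof.
rewrite /tail_weight; case: ifPn => [_|]; first exact: ltr01.
by rewrite -ltNge => t1; rewrite powR_gt0// (lt_trans ltr01).
Qed.

Lemma measurable_tail_weight s : measurable_fun setT (tail_weight s).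
Proof.
apply: measurable_fun_if => //=.
- exact: measurable_fun_ler.
- by apply: measurable_funTS; exact: measurable_normpowR.
Qed.

(** The integrand is even, at most 1 on [[0, 1]], and equal to [t ^ (- (s / 2 - p + 1))] beyond 1,
    where [s > 2p] makes the exponent smaller than -1. *)
Lemma integral_tail_weight_lty (p s : R) : 1 <= p -> 2 * p < s ->
  (\int[leb]_t (`|t| `^ (p - 1) * tail_weight s t)%:E < +oo)%E.
Proof.
move=> p1 ps; pose f (t : R) := (`|t| `^ (p - 1) * tail_weight s t)%:E.
have f0 t : (0 <= f t)%E by rewrite lee_fin mulr_ge0 ?powR_ge0// ltW// tail_weight_gt0.
have mf : measurable_fun [set: measurableTypeR R] f.
  apply/measurable_EFinP; apply: measurable_funM; first exact: measurable_normpowR.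
  exact: measurable_tail_weight.
have fN t : f (- t) = f t by rewrite /f /tail_weight normrN.
have half : (\int[leb]_(t in `[0%R, +oo[) f t < +oo)%E.
  rewrite (_ : `[0%R, +oo[%classic = `[0%R, 1%R] `|` (`]1%R, +oo[%classic : set R)); last first.
    apply/seteqP; split => t /=; rewrite !in_itv/= !andbT.
      by move=> t0; have [?|?] := leP t 1; [left; rewrite t0|right].
    by move=> [/andP[]//|/ltW]; exact: le_trans.
  rewrite ge0_integral_setU//=; last 2 first.
  - exact: measurable_funTS.
  - apply/disj_setPS => t [] /=; rewrite !in_itv/= andbT => /andP[_ t1].
    by rewrite ltNge t1.
  rewrite lte_add_pinfty//.
    apply: (@le_lt_trans _ _ (\int[leb]_(t in `[0%R, 1%R]) 1)%E).
      apply: ge0_le_integral => //; first exact: measurable_funTS.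
      move=> t /=; rewrite in_itv/= => /andP[t0 t1].
      rewrite /f /tail_weight ger0_norm// t1 mulr1 lee_fin.
      apply: (@le_trans _ _ (1 `^ (p - 1))); last by rewrite powR1.
      by apply: ge0_ler_powR; rewrite ?nnegrE// subr_ge0.
    by rewrite integral_cst//= mul1e lebesgue_measure_itv/=; case: ifP => // _; rewrite ltry.
  have e1 : 1 < s / 2 - p + 1 by lra.
  apply: (@le_lt_trans _ _ (\int[leb]_(t in `[1%R, +oo[) (t `^ (- (s / 2 - p + 1)))%:E)%E).
    rewrite -integral_itv_obnd_cbnd; last first.
      by apply/measurable_EFinP/measurable_funTS; exact: measurable_powR.
    apply: ge0_le_integral => //; first exact: measurable_funTS.
      by apply/measurable_EFinP/measurable_funTS; exact: measurable_powR.
    move=> t /=; rewrite in_itv/= andbT => t1; have t0 := lt_trans ltr01 t1.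
    rewrite /f /tail_weight gtr0_norm// (leNgt t 1) t1/= -powRD.
      by rewrite le_eqVlt; apply/orP; left; apply/eqP; congr (_ `^ _)%:E; lra.
    by rewrite (gt_eqF t0) implybT.
  by rewrite integral_powR_tail// ltry.
have neg : (\int[leb]_(t in `]-oo, 0%R]) f t < +oo)%E.
  under eq_integral do rewrite -fN.
  by rewrite -ge0_integration_by_substitution0.
have pos : (\int[leb]_(t in `]0%R, +oo[) f t < +oo)%E.
  apply: le_lt_trans half; apply: ge0_subset_integral => //; first exact: measurable_funTS.
  by move=> t /=; rewrite !in_itv/= !andbT => /ltW.
rewrite -/f -(setUv `]-oo, 0%R]%classic) setCitvl.
rewrite ge0_integral_setU//=; last 3 first.
- exact: measurable_funTS.
- by move=> t _; exact: f0.
- by apply/disj_setPS => t [] /=; rewrite !in_itv/= andbT => t0; rewrite ltNge t0.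
exact: lte_add_pinfty.
Qed.

End tail_integral.

(** * Slices of the empirical measure *)

(** Simple functions below [f] are also below [g], so the first supremum is over a smaller set. This
    compares [Wpp] and [SW] with their measurable majorants. *)
Lemma le_lower_integral d (T : measurableType d) (R : realType)
    (mu : {measure set T -> \bar R}) (D : set T) (f g : T -> \bar R) :
  (forall x, D x -> 0 <= f x)%E -> (forall x, D x -> f x <= g x)%E ->
  (\int[mu]_(x in D) f x <= \int[mu]_(x in D) g x)%E.
Proof.
move=> f0 fg; have g0 x : D x -> (0 <= g x)%E.
  by move=> Dx; rewrite (le_trans (f0 x Dx))// fg.
rewrite !ge0_integralE//; apply: ge_ereal_sup => _ [h/= hf <-].
apply: ereal_sup_ubound; exists h => //= x; rewrite (le_trans (hf x))//.
by rewrite !patchE; case: ifPn => // /set_mem/fg.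
Qed.

Section sliced.
Context {R : realType} (p : R) {X : completeNormedModType R} (ip : X -> X -> R).
Hypothesis p1 : 1 <= p.
Hypothesis hX : sep_infdim_Hilbert ip.
Variable mu : probability (borelX X) R.
Local Notation leb := (@lebesgue_measure R).

Let ipX : is_inner_product ip. Proof. by case: hX. Qed.
Let sepX : exists D : set X, countable D /\ closure D = setT. Proof. by case: hX. Qed.

Definition slice_cdf (theta : borelX X) (t : R) : R :=
  fine (mu [set x : borelX X | ip theta x <= t]).

Lemma measurable_slice theta t : measurable ([set x : borelX X | ip theta x <= t] : set (borelX X)).
Proof.
rewrite (_ : [set _ | _] = (ip theta : borelX X -> R) @^-1` `]-oo, t]).
  by rewrite -[X in measurable X]setTI; exact: (measurable_ipr ipX sepX theta).
by apply/seteqP; split => x /=; rewrite in_itv.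
Qed.

Lemma slice_cdfE theta t :
  mu [set x : borelX X | ip theta x <= t] = (slice_cdf theta t)%:E.
Proof.
rewrite /slice_cdf fineK// fin_num_measure//; exact: measurable_slice.
Qed.

(** The set [B] is measurable because [ip] is jointly so, and [slice_cdf] is the [mu]-measure of its
    sections. *)
Lemma measurable_slice_cdf :
  measurable_fun setT (fun z : borelX X * R => slice_cdf z.1 z.2).
Proof.
apply: (@measurableT_comp _ _ _ _ _ _ (@fine R)) => //.
pose B := [set y : (borelX X * R) * borelX X | ip y.1.1 y.2 <= y.1.2].
have mB : measurable B.
  rewrite (_ : B = (fun y => ip y.1.1 y.2 <= y.1.2) @^-1` [set true]).
    rewrite -[X in measurable X]setTI.
    apply: (measurable_fun_ler _ _ measurableT) => //.
    - have mpair : measurable_fun setT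
          (fun y : (borelX X * R) * borelX X => (y.1.1, y.2)).
        by apply: measurable_fun_pair => //; exact: measurableT_comp.
      exact: (measurableT_comp (measurable_ip ipX sepX) mpair).
    - exact: (measurableT_comp measurable_snd measurable_fst).
  by [].
apply: (eq_measurable_fun (mu \o xsection B)); last exact: measurable_fun_xsection.
by move=> z _ /=; congr (mu _); apply/seteqP; split => x /=; rewrite /xsection/= inE.
Qed.

Definition slice_dev (n : nat) (xs : 'I_n -> borelX X) (theta : borelX X) (t : R) : R :=
  n%:R^-1 * (\sum_(k < n) (ip theta (xs k) <= t)%R%:R) - slice_cdf theta t.

(** [ip theta] is one random variable under two probabilities, the empirical one and [mu]; its
    distributions are the two slices, and its distribution functions differ by [slice_dev]. *)
Lemma Wpp_slice_le (n : nat) (xs : 'I_n.+1 -> borelX X) (theta : borelX X) :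
  (Wpp p (proj_measure ip theta (empirical xs)) (proj_measure ip theta mu) <=
   (4 `^ p)%:E * \int[leb]_t (`|t| `^ (p - 1) * `|slice_dev xs theta t|)%:E)%E.
Proof.
have [Pn PnE] := empirical_probability xs.
pose q : {mfun borelX X >-> R} := HB.pack (ip theta : borelX X -> R)
  (isMeasurableFun.Build _ _ _ _ _ (measurable_ipr ipX sepX theta)).
have -> : proj_measure ip theta (empirical xs) = distribution Pn q.
  by rewrite -PnE.
have -> : proj_measure ip theta mu = distribution mu q by [].
rewrite (le_trans (Wpp_le_cdf (q : {RV Pn >-> R}) (q : {RV mu >-> R}) p1))//.
rewrite le_eqVlt; apply/orP; left; apply/eqP; congr (_ * _)%E.
apply: eq_integral => t _; congr (_ * `|_ - _|)%:E; rewrite /rcdf /cdf /distribution /pushforward.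
  rewrite PnE /empirical sumEFin -EFinM/=; congr (_ * _).
  apply: eq_bigr => k _; rewrite indicE; congr (nat_of_bool _)%:R.
  by apply/idP/idP; rewrite inE/= in_itv.
Qed.

End sliced.

(** * Deviation of a slice, uniformly in the direction *)

Section slice_deviation.
Context {R : realType} (p s : R) {X : completeNormedModType R} (ip : X -> X -> R).
Hypothesis p1 : 1 <= p.
Hypothesis ps : 2 * p < s.
Hypothesis hX : sep_infdim_Hilbert ip.
Variable mu : probability (borelX X) R.
Hypothesis mufin : (moment s mu < +oo)%E.
Local Notation M := (fine (moment s mu)).

Let ipX : is_inner_product ip. Proof. by case: hX. Qed.
Let sepX : exists D : set X, countable D /\ closure D = setT. Proof. by case: hX. Qed.

Let s0 : 0 < s. Proof. by move: p1 ps; lra. Qed.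

Let mnormX : measurable_fun setT (fun x : borelX X => (`|x : X| `^ s)%:E).
Proof.
apply/measurable_EFinP.
exact: (measurableT_comp (@measurable_powR R s) (@measurable_norm_borelX R X)).
Qed.

Lemma moment_ge0 : 0 <= M.
Proof. by apply: fine_ge0; apply: integral_ge0 => x _; rewrite lee_fin powR_ge0. Qed.

Lemma moment_markov (r : R) : 0 < r ->
  (mu [set x : borelX X | (r <= `|x : X|)%R] <= (M * r `^ (- s))%:E)%E.
Proof.
move=> r0; set A := [set x | _].
have mA : measurable A.
  rewrite (_ : A = (fun x : borelX X => `|x : X| : R) @^-1` `[r, +oo[).
    by rewrite -[X in measurable X]setTI; exact: measurable_norm_borelX.
  by apply/seteqP; split => x /=; rewrite in_itv/= andbT.
have Mfin : (M%:E = moment s mu).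
  rewrite fineK// ge0_fin_numE//.
  by apply: integral_ge0 => x _; rewrite lee_fin powR_ge0.
rewrite EFinM Mfin powRN lee_pdivlMr ?powR_gt0//.
apply: (@le_trans _ _ (\int[mu]_(x in A) (r `^ s)%:E)%E).
  by rewrite integral_cst// muleC.
apply: (@le_trans _ _ (\int[mu]_(x in A) (`|x : X| `^ s)%:E)%E).
  apply: ge0_le_integral => //.
  - by move=> x _; rewrite lee_fin powR_ge0.
  - exact: measurable_funTS.
  - move=> x rx; rewrite lee_fin; apply: ge0_ler_powR => //.
    + exact: ltW.
    + by rewrite nnegrE ltW.
    + by rewrite nnegrE.
by apply: ge0_subset_integral => // x _; rewrite lee_fin powR_ge0.
Qed.

Lemma slice_cdf01 theta t : 0 <= slice_cdf ip mu theta t <= 1.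
Proof.
rewrite -!lee_fin -(slice_cdfE hX mu theta t) measure_ge0/=.
exact: probability_le1 (measurable_slice hX theta t).
Qed.

(** For [|t| <= 1], [q (1 - q) <= 1] is enough. Beyond, the factor that is a tail, [q] for negative
    [t] and [1 - q] for positive [t], is the mass of a set contained in [|x| >= |t|] by
    Cauchy-Schwarz, and Markov's inequality applies. The constant [M + 1] covers both cases. *)
Lemma slice_variance_le (theta : X) (t : R) : `|theta| = 1 ->
  slice_cdf ip mu theta t * (1 - slice_cdf ip mu theta t) <=
  (M + 1) * tail_weight s t ^+ 2.
Proof.
move=> theta1; set q := slice_cdf _ _ _ _.
have /andP[q0 q1] : 0 <= q <= 1 := slice_cdf01 theta t.
have q11 : q * (1 - q) <= 1 by nra.
rewrite /tail_weight; case: ifPn => [_|].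
  by rewrite expr1n mulr1 (le_trans q11)// lerDr moment_ge0.
rewrite -ltNge => t1; have t0 : 0 < `|t| := lt_trans ltr01 t1.
have -> : (`|t| `^ (- (s / 2))) ^+ 2 = `|t| `^ (- s).
  by rewrite -powR_mulrn ?powR_ge0// -powRrM; congr (_ `^ _); field.
apply: (@le_trans _ _ (M * `|t| `^ (- s))); last first.
  by rewrite ler_wpM2r ?powR_ge0// lerDl.
have := moment_markov t0; set A := [set x | _] => muA.
have mA : measurable A.
  rewrite (_ : A = (fun x : borelX X => `|x : X| : R) @^-1` `[`|t|, +oo[).
    by rewrite -[X in measurable X]setTI; exact: measurable_norm_borelX.
  by apply/seteqP; split => x /=; rewrite in_itv/= andbT.
have mB := measurable_slice hX theta t.
have [tneg|tpos] := ltP t 0.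
  suff : q <= M * `|t| `^ (- s) by nra.
  rewrite -lee_fin; apply: le_trans muA; rewrite -(slice_cdfE hX).
  apply: le_measure; rewrite ?inE// => x /= h; rewrite /A/=.
  rewrite (le_trans _ (ip_le_norm ipX x theta1))// ltr0_norm// -normrN.
  by rewrite (le_trans _ (ler_norm _))// lerN2.
suff : 1 - q <= M * `|t| `^ (- s) by nra.
rewrite -lee_fin; apply: le_trans muA; rewrite EFinB -(slice_cdfE hX).
rewrite -probability_setC//; apply: le_measure; rewrite ?inE//; first exact: measurableC.
move=> x /= /negP; rewrite -ltNge => h; rewrite /A/=.
rewrite (le_trans _ (ip_le_norm ipX x theta1))// ger0_norm//.
by rewrite (le_trans _ (ler_norm _))// ltW.
Qed.

Lemma measurable_slice_dev d (Omega : measurableType d) (n : nat)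
    (Xs : 'I_n -> Omega -> borelX X) :
  (forall k, measurable_fun setT (Xs k)) ->
  measurable_fun setT (fun z : (Omega * borelX X) * R =>
    slice_dev ip mu (fun k => Xs k z.1.1) z.1.2 z.2).
Proof.
move=> mXs; apply: measurable_funB.
  apply: measurable_funM => //; apply: measurable_sum => k.
  apply: (@measurableT_comp _ _ _ _ _ _ (fun b : bool => b%:R : R)) => //.
  apply: measurable_fun_ler => //.
  have mpair : measurable_fun setT
      (fun z : (Omega * borelX X) * R => (z.1.2, Xs k z.1.1)).
    apply: measurable_fun_pair.
      exact: (measurableT_comp measurable_snd measurable_fst).
    apply: measurableT_comp => //.
    exact: (measurableT_comp measurable_fst measurable_fst).
  exact: (measurableT_comp (measurable_ip ipX sepX) mpair).
have mpair : measurable_fun setT (fun z : (Omega * borelX X) * R => (z.1.2, z.2)).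
  apply: measurable_fun_pair => //.
  exact: (measurableT_comp measurable_snd measurable_fst).
exact: (measurableT_comp (measurable_slice_cdf hX mu) mpair).
Qed.

(** The product formula is applied to the family equal to [B] at [k] and [l] and to the whole space
    elsewhere. *)
Lemma iid_pairwise d (Omega : measurableType d) (P : probability Omega R) (n : nat)
    (Xs : 'I_n -> Omega -> borelX X) (B : set (borelX X)) (k l : 'I_n) :
  iid P Xs mu -> measurable B -> k != l ->
  P (Xs k @^-1` B `&` Xs l @^-1` B) = (mu B * mu B)%E.
Proof.
move=> [mXs law indep] mB kl.
pose A (j : 'I_n) := if (j == k) || (j == l) then B else setT.
have mA j : measurable (A j) by rewrite /A; case: ifP.
have -> : Xs k @^-1` B `&` Xs l @^-1` B = [set w | forall j, A j (Xs j w)].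
  apply/seteqP; split => w /=.
    by move=> [Bk Bl] j; rewrite /A; case: ifPn => // /orP[/eqP->|/eqP->].
  by move=> h; split; [have := h k|have := h l]; rewrite /A eqxx ?orbT.
rewrite indep// (bigD1 k)//= (bigD1 l) 1?eq_sym//= big1 ?mule1; last first.
  move=> j /andP[jk jl]; rewrite /A (negbTE jk) (negbTE jl)/= preimage_setT.
  exact: probability_setT.
by rewrite !law// /A !eqxx orbT.
Qed.

(** With [theta] and [t] fixed, [slice_dev] is the deviation of the frequency of the events
    [ip theta (Xs k) <= t] from their common probability. *)
Lemma expected_slice_dev_le d (Omega : measurableType d) (P : probability Omega R)
    (n : nat) (Xs : 'I_n -> Omega -> borelX X) (theta : X) (t : R) :
  (0 < n)%N -> iid P Xs mu -> `|theta| = 1 ->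
  (\int[P]_w (`|slice_dev ip mu (fun k => Xs k w) theta t|)%:E <=
   (Num.sqrt ((M + 1) / n%:R) * tail_weight s t)%:E)%E.
Proof.
move=> n0 iidX theta1; have [mXs law _] := iidX.
pose B := [set x : borelX X | ip theta x <= t].
have mB : measurable B := measurable_slice hX theta t.
pose E k := Xs k @^-1` B.
have mE k : measurable (E k) by rewrite -[X in measurable X]setTI; exact: mXs.
have nR0 : (0 : R) < n%:R by rewrite ltr0n.
have M1 : 0 < M + 1 by rewrite ltr_wpDl// moment_ge0.
have c0 : 0 < (M + 1) / n%:R by rewrite divr_gt0.
have := @integral_deviation_le _ Omega R P n E (slice_cdf ip mu theta t) n0 mE.
(* The bound [a] is chosen so that [n a^2] is exactly the right side of [slice_variance_le]. *)
move=> /(_ _ _ (Num.sqrt ((M + 1) / n%:R) * tail_weight s t)).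
have PE k : P (E k) = (slice_cdf ip mu theta t)%:E.
  by rewrite law//; exact: slice_cdfE.
have PEE k l : k != l -> P (E k `&` E l) = (slice_cdf ip mu theta t ^+ 2)%:E.
  by move=> kl; rewrite (iid_pairwise iidX mB kl) (slice_cdfE hX) -EFinM expr2.
move=> /(_ PE PEE); rewrite mulr_gt0 ?sqrtr_gt0 ?tail_weight_gt0// => /(_ isT).
have -> : n%:R * (Num.sqrt ((M + 1) / n%:R) * tail_weight s t) ^+ 2 =
    (M + 1) * tail_weight s t ^+ 2.
  by rewrite exprMn sqr_sqrtr ?(ltW c0)//; field; rewrite gt_eqF.
move=> /(_ (slice_variance_le t theta1)); apply: le_trans.
rewrite le_eqVlt; apply/orP; left; apply/eqP; apply: eq_integral => w _.
congr (`|_ * _ - _|)%:E; apply: eq_bigr => k _; rewrite indicE; congr (nat_of_bool _)%:R.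
by apply/idP/idP; rewrite inE.
Qed.

End slice_deviation.

(* Used in place of Jensen's inequality for the concave function [x `^ q]. *)
Lemma poweR_le_linear (R : realType) (q a : R) (y : \bar R) :
  0 < a -> 0 < q <= 1 -> (0 <= y)%E ->
  (poweR y q <= (a `^ q)%:E + (a `^ (q - 1))%:E * y)%E.
Proof.
move=> a0 /andP[q0 q1]; case: y => [r| |] //; last first.
  by move=> _; rewrite gt0_muley ?lte_fin ?powR_gt0// addey// leey.
rewrite lee_fin => r0; rewrite poweR_EFin -EFinM -EFinD lee_fin.
have aq : 0 <= a `^ (q - 1) * r by rewrite mulr_ge0 ?powR_ge0.
(* Up to [a] the constant term dominates. Above it, [r / a >= 1] gives [(r / a) ^ q <= r / a], which
   is the linear term after multiplication by [a ^ q]. *)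
have [ra|ar] := leP r a.
  apply: (@le_trans _ _ (a `^ q)); last by rewrite lerDl.
  by apply: ge0_ler_powR; rewrite ?nnegrE// ?ltW.
apply: (@le_trans _ _ (a `^ (q - 1) * r)); last by rewrite lerDr powR_ge0.
have ra1 : 1 <= r / a by rewrite ler_pdivlMr// mul1r ltW.
rewrite -{1}(divfK (lt0r_neq0 a0) r) powRM ?(ltW a0) ?(le_trans ler01 ra1)//.
rewrite -(mulr_powRB1 (ltW a0) q0) mulrA mulrC ler_wpM2l ?powR_ge0//.
by rewrite -ler_pdivlMr// ler1_powR.
Qed.

(** * Average over the directions and final rate *)

Section sliced_rate.
Context {R : realType} (p s : R) {X : completeNormedModType R} (ip : X -> X -> R).
Hypothesis p1 : 1 <= p.
Hypothesis ps : 2 * p < s.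
Hypothesis hX : sep_infdim_Hilbert ip.
Variable gamma : {finite_measure set (borelX X) -> \bar R}.
Hypothesis gammaS : (0 < gamma (@sphere R X))%E.
Variable mu : probability (borelX X) R.
Hypothesis mufin : (moment s mu < +oo)%E.
Context d (Omega : measurableType d) (P : probability Omega R) (n : nat).
Variable Xs : 'I_n.+1 -> Omega -> borelX X.
Hypothesis iidX : iid P Xs mu.
Local Notation leb := (@lebesgue_measure R).
Local Notation M := (fine (moment s mu)).

(** A function of [p] and [s] only; the integral is finite by [integral_tail_weight_lty], so [fine]
    preserves its value. *)
Definition tail_constant : R := fine (\int[leb]_t (`|t| `^ (p - 1) * tail_weight s t)%:E)%E.

Let c : R := Num.sqrt ((M + 1) / n.+1%:R).

(** Majorant of the cost [Wpp] of a slice, jointly measurable in the sample point and the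
    direction. *)
Let D (w : Omega) (theta : borelX X) : \bar R :=
  ((4 `^ p)%:E * \int[leb]_t
     (`|t| `^ (p - 1) * `|slice_dev ip mu (fun k => Xs k w) theta t|)%:E)%E.

Let mXs k : measurable_fun setT (Xs k). Proof. by case: iidX. Qed.

Let H (z : (Omega * borelX X) * R) : \bar R :=
  (`|z.2| `^ (p - 1) * `|slice_dev ip mu (fun k => Xs k z.1.1) z.1.2 z.2|)%:E.

Let H0 z : (0 <= H z)%E.
Proof. by rewrite lee_fin mulr_ge0// powR_ge0. Qed.

Let mH : measurable_fun setT H.
Proof.
apply/measurable_EFinP; apply: measurable_funM.
  exact: (measurableT_comp (measurable_normpowR _) measurable_snd).
by apply: measurableT_comp => //; exact: measurable_slice_dev.
Qed.

Let D0 w theta : (0 <= D w theta)%E.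
Proof.
apply: mule_ge0; first by rewrite lee_fin powR_ge0.
by apply: integral_ge0 => t _; exact: (H0 ((w, theta), t)).
Qed.

Let mD : measurable_fun setT (fun z : Omega * borelX X => D z.1 z.2).
Proof.
apply: emeasurable_funM => //.
have := @measurable_fun_fubini_tonelli_F _ _ _ _ _ leb _ mH H0.
by apply: eq_measurable_fun => -[w theta] _.
Qed.

(** Tonelli's theorem moves the expectation inside the integral over [t], where the deviation bound
    leaves [c] times the weight that integrates to [tail_constant]. *)
Let expected_D (theta : X) : `|theta| = 1 ->
  (\int[P]_w D w theta <= (4 `^ p * (c * tail_constant))%:E)%E.
Proof.
move=> theta1.
pose G (z : Omega * R) := H ((z.1, theta : borelX X), z.2).
have mG : measurable_fun setT G.
  have mpair : measurable_fun setT
      (fun z : Omega * R => ((z.1, theta : borelX X), z.2)).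
    by apply: measurable_fun_pair => //; exact: measurable_fun_pair.
  exact: (measurableT_comp mH mpair).
have G0 z : (0 <= G z)%E by exact: H0.
have mGF : measurable_fun setT (fun w => \int[leb]_t G (w, t))%E.
  exact: (@measurable_fun_fubini_tonelli_F _ _ _ _ _ leb G).
have mGG : measurable_fun [set: measurableTypeR R] (fun t => \int[P]_w G (w, t))%E.
  exact: (@measurable_fun_fubini_tonelli_G _ _ _ _ _ P G).
have -> : (\int[P]_w D w theta = (4 `^ p)%:E * \int[P]_w \int[leb]_t G (w, t))%E.
  rewrite -ge0_integralZl//.
  by move=> w _; apply: integral_ge0 => t _; exact: H0.
rewrite EFinM lee_pmul2l// ?lte_fin ?powR_gt0//.
have -> : (\int[P]_w \int[leb]_t G (w, t) = \int[leb]_t \int[P]_w G (w, t))%E.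
  exact: (@fubini_tonelli _ _ _ _ _ P leb G).
have mw : measurable_fun [set: measurableTypeR R]
    (fun t => (`|t| `^ (p - 1) * tail_weight s t)%:E).
  apply/measurable_EFinP; apply: measurable_funM; first exact: measurable_normpowR.
  exact: measurable_tail_weight.
have w0 (t : R) : (0 <= (`|t| `^ (p - 1) * tail_weight s t)%:E)%E.
  by rewrite lee_fin mulr_ge0 ?powR_ge0// ltW// tail_weight_gt0.
rewrite EFinM /tail_constant fineK; last first.
  by rewrite ge0_fin_numE ?integral_tail_weight_lty//; exact: integral_ge0.
rewrite -ge0_integralZl//; last by rewrite lee_fin sqrtr_ge0.
apply: ge0_le_integral => //.
- by move=> t _; apply: integral_ge0 => w _; exact: H0.
- exact: emeasurable_funM.
move=> t _; rewrite /G /H/=; under eq_integral do rewrite EFinM.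
rewrite ge0_integralZl//; last first.
  apply/measurable_EFinP; apply: measurableT_comp => //.
  have mpair : measurable_fun setT (fun w : Omega => ((w, theta : borelX X), t)).
    by apply: measurable_fun_pair => //; exact: measurable_fun_pair.
  exact: (measurableT_comp (measurable_slice_dev hX mu mXs) mpair).
rewrite -EFinM mulrCA EFinM lee_wpmul2l// ?lee_fin ?powR_ge0//.
exact: (expected_slice_dev_le p1 ps hX mufin t (ltn0Sn n) iidX theta1).
Qed.

Let Z (w : Omega) : \bar R :=
  (((fine (gamma (@sphere R X)))^-1)%:E * \int[gamma]_(theta in @sphere R X) D w theta)%E.

Let S := @sphere R X.
Let mS : measurable S. Proof. exact: measurable_sphere. Qed.

(** The sphere enters as an indicator factor, since Tonelli's theorem is applied on the whole
    product space. *)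
Let DS (z : Omega * borelX X) : \bar R := (D z.1 z.2 * (\1_S z.2)%:E)%E.

Let DS0 z : (0 <= DS z)%E. Proof. by rewrite mule_ge0// lee_fin. Qed.

Let mDS : measurable_fun setT DS.
Proof.
apply: emeasurable_funM => //; apply/measurable_EFinP.
exact: (measurableT_comp (measurable_indic mS) measurable_snd).
Qed.

Let ZE w : Z w = (((fine (gamma S))^-1)%:E * \int[gamma]_theta DS (w, theta))%E.
Proof.
by rewrite /Z integral_mkcond epatch_indic.
Qed.

Let mDSF : measurable_fun setT (fun w => \int[gamma]_theta DS (w, theta))%E.
Proof. exact: (@measurable_fun_fubini_tonelli_F _ _ _ _ _ gamma DS). Qed.

Let mZ : measurable_fun setT Z.
Proof.
apply: (eq_measurable_fun (fun w => ((fine (gamma S))^-1)%:E * \int[gamma]_theta DS (w, theta))%E).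
  by move=> w _; rewrite ZE.
exact: emeasurable_funM.
Qed.

Let gS0 : 0 < fine (gamma S).
Proof. by rewrite -lte_fin fineK// fin_num_measure. Qed.

Let Z0 w : (0 <= Z w)%E.
Proof.
rewrite ZE mule_ge0// ?lee_fin ?invr_ge0 ?(ltW gS0)//.
exact: integral_ge0.
Qed.

(** The bound on the expectation of [D] is the same in every direction, so the mass of the sphere
    cancels against the normalization and the result is free of [gamma]. *)
Let expected_Z : (\int[P]_w Z w <= (4 `^ p * (c * tail_constant))%:E)%E.
Proof.
under eq_integral do rewrite ZE.
rewrite ge0_integralZl//; last 2 first.
- by move=> w _; exact: integral_ge0.
- by rewrite lee_fin invr_ge0 ltW.
rewrite lee_pdivrMl//.
have -> : (\int[P]_w \int[gamma]_theta DS (w, theta) = \int[gamma]_theta \int[P]_w DS (w, theta))%E.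
  exact: (@fubini_tonelli _ _ _ _ _ P gamma DS).
apply: (@le_trans _ _ (\int[gamma]_theta ((4 `^ p * (c * tail_constant))%:E * (\1_S theta)%:E))%E).
  apply: ge0_le_integral => //.
  - by move=> theta _; exact: integral_ge0.
  - exact: (@measurable_fun_fubini_tonelli_G _ _ _ _ _ P DS).
  - by apply: emeasurable_funM => //; exact/measurable_EFinP/measurable_indic.
  - move=> theta _; rewrite /DS/= indicE; case: (boolP (theta \in S)) => [/set_mem thS|_].
      by rewrite mule1; under eq_integral do rewrite mule1; exact: expected_D.
    by rewrite mule0; under eq_integral do rewrite mule0; rewrite integral0.
have K0 : (0 <= (4 `^ p * (c * tail_constant))%:E)%E.
  rewrite lee_fin !mulr_ge0 ?powR_ge0 ?sqrtr_ge0//; apply: fine_ge0.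
  apply: integral_ge0 => t _.
  by rewrite lee_fin mulr_ge0 ?powR_ge0// ltW// tail_weight_gt0.
rewrite ge0_integralZl//; last by exact/measurable_EFinP/measurable_indic.
by rewrite integral_indic// setIT fineK ?fin_num_measure// muleC.
Qed.

Let Wpp_ge0 m1 m2 : (0 <= Wpp p m1 m2)%E.
Proof.
apply: le_ereal_inf_tmp => _ [pi _ <-].
by apply: integral_ge0 => z _; rewrite lee_fin powR_ge0.
Qed.

Let SWpp_ge0 w : (0 <= SWpp ip p gamma (empirical (fun k => Xs k w)) mu)%E.
Proof.
apply: mule_ge0; first by rewrite lee_fin invr_ge0 ltW.
by apply: integral_ge0 => theta _; exact: Wpp_ge0.
Qed.

Let SWpp_le_Z w : (SWpp ip p gamma (empirical (fun k => Xs k w)) mu <= Z w)%E.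
Proof.
apply: lee_wpmul2l; first by rewrite lee_fin invr_ge0 ltW.
apply: le_lower_integral => theta _; first exact: Wpp_ge0.
exact: Wpp_slice_le.
Qed.

Lemma expected_SW_le :
  (\int[P]_w SW ip p gamma (empirical (fun k => Xs k w)) mu <=
   ((1 + 4 `^ p * (Num.sqrt (M + 1) * tail_constant)) *
      n.+1%:R `^ (- (2 * p)^-1))%:E)%E.
Proof.
have p0 : 0 < p by rewrite (lt_le_trans ltr01).
have n0 : (0 : R) < n.+1%:R by rewrite ltr0n.
(* The order of the bound on the expectation of [Z]. Linearizing the power [1 / p] at this scale
   makes both terms multiples of [a ^ (1 / p)], which is the announced rate. *)
pose a : R := n.+1%:R `^ (- 2^-1).
have a0 : 0 < a by rewrite powR_gt0.
have q01 : 0 < p^-1 <= 1 by rewrite invr_gt0 p0 invf_le1.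
have b0 : 0 <= a `^ (p^-1 - 1) by rewrite powR_ge0.
apply: (@le_trans _ _ (\int[P]_w ((a `^ p^-1)%:E + (a `^ (p^-1 - 1))%:E * Z w))%E).
  apply: le_lower_integral => w _; first exact: poweR_ge0.
  apply: le_trans (poweR_le_linear a0 q01 (SWpp_ge0 w)) _.
  by rewrite leeD2l// lee_wpmul2l.
rewrite ge0_integralD//; last 3 first.
- by move=> w _; rewrite lee_fin powR_ge0.
- by move=> w _; rewrite mule_ge0.
- exact: emeasurable_funM.
rewrite ge0_integralZl// integral_cst// [X in (_ * X + _)%E](probability_setT P) mule1.
apply: (@le_trans _ _ ((a `^ p^-1)%:E + (a `^ (p^-1 - 1))%:E * (4 `^ p * (c * tail_constant))%:E)%E).
  by rewrite leeD2l// lee_wpmul2l.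
rewrite -EFinM -EFinD lee_fin.
have cE : c = Num.sqrt (M + 1) * a.
  rewrite /c sqrtrM ?addr_ge0// ?(moment_ge0 s mu)//; congr (_ * _).
  by rewrite /a powRN powR12_sqrt ?sqrtrV.
have -> : n.+1%:R `^ (- (2 * p)^-1) = a `^ p^-1.
  by rewrite /a -powRrM invfM mulNr.
have aE : a `^ (p^-1 - 1) * a = a `^ p^-1.
  by rewrite mulrC mulr_powRB1// ?invr_gt0// ltW.
rewrite cE mulrDl mul1r lerD2l le_eqVlt; apply/orP; left; apply/eqP.
rewrite -aE; ring.
Qed.

End sliced_rate.

(** A copy of [m] with the proof [mT] among its arguments, to which the finite measure structure
    demanded by the previous section can be attached. *)
Definition finite_measure_of d (T : measurableType d) (R : realType)
  (m : {measure set T -> \bar R}) (mT : (m setT < +oo)%E) : set T -> \bar R := m.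

Section finite_measure_of.
Context d (T : measurableType d) (R : realType) (m : {measure set T -> \bar R}).
Hypothesis mT : (m setT < +oo)%E.
Local Notation fm := (finite_measure_of mT).

HB.instance Definition _ := isMeasure.Build _ _ _ fm (measure0 m) (measure_ge0 m)
  (@measure_semi_sigma_additive _ _ _ m).

Let fm_fin : fin_num_fun fm.
Proof.
move=> A mA; rewrite ge0_fin_numE// (le_lt_trans _ mT)//.
by apply: le_measure; rewrite ?inE.
Qed.

HB.instance Definition _ := Measure_isFinite.Build _ _ _ fm fm_fin.

End finite_measure_of.

Theorem mainTheorem8 (R : realType) (p s : R) (hp : 1 <= p) (hs : 2 * p < s) :
  exists C : R -> R,
  forall (X : completeNormedModType R) (ip : X -> X -> R),
  sep_infdim_Hilbert ip ->
  forall gamma : {measure set (borelX X) -> \bar R},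
  (gamma setT < +oo)%E -> gamma (~` @sphere R X) = 0%E -> (0 < gamma (@sphere R X))%E ->
  forall mu : probability (borelX X) R,
  (moment s mu < +oo)%E ->
  forall (n : nat), (0 < n)%N ->
  forall (d : measure_display) (Omega : measurableType d) (P : probability Omega R)
    (Xs : 'I_n -> Omega -> borelX X),
  iid P Xs mu ->
  (\int[P]_w SW ip p gamma (empirical (fun k => Xs k w)) mu
     <= (C (fine (moment s mu)) * n%:R `^ (- (2 * p)^-1))%:E)%E.
Proof.
(* Chosen before the space, the measures and the sample: apart from [p] and [s], only the moment
   enters. *)
exists (fun M => 1 + 4 `^ p * (Num.sqrt (M + 1) * tail_constant p s)).
move=> X ip hX gamma gfin _ gS mu mufin [//|n] _ d Omega P Xs iidX.
exact: (expected_SW_le hp hs hX (gamma := finite_measure_of gfin) gS mufin iidX).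
Qed.
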